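(* A generic compact subset of $\mathbb{R}$ is visible; that is, the set of those $K\in\mathcal{C}(\mathbb{R})$ for which there exists a translation invariant Borel measure $\mu$ on $\mathbb{R}$ with $0<\mu(K)<\infty$ is comeager in $\mathcal{C}(\mathbb{R})$.
   Context: $\mathcal{C}(\mathbb{R})$ is the space of all (nonempty) compact subsets of $\mathbb{R}$ with the Hausdorff metric; it is a Polish space. A set is comeager if its complement is meager, i.e. a countable union of nowhere dense sets. A translation invariant Borel measure on $\mathbb{R}$ is a countably additive measure $\mu$ on the Borel sets of $\mathbb{R}$ with values in $[0,\infty]$ (not assumed $\sigma$-finite or locally finite) such that $\mu(A+t)=\mu(A)$ for all Borel $A$ and all $t\in\mathbb{R}$. *)

(* Defs.v *)
From HB Require Import structures.
From mathcomp Require Import all_boot all_order all_algebra.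
From mathcomp Require Import all_classical all_reals all_analysis.
From mathcomp Require Import measurable_realfun.

Set Implicit Arguments.
Unset Strict Implicit.
Unset Printing Implicit Defensive.

Import Order.TTheory GRing.Theory Num.Theory.
Import numFieldNormedType.Exports.

Local Open Scope classical_set_scope.
Local Open Scope ring_scope.

Section baire_category.
Context {T : topologicalType}.
Implicit Type A : set T.

Definition nowhere_dense A := (closure A)° = set0.

Definition meager A := exists F : (set T)^nat,
  (forall n, nowhere_dense (F n)) /\ A = \bigcup_n F n.

Definition comeager A := meager (~` A).

End baire_category.

(* inf and sup are total on R, with a junk value on empty or unbounded sets;
   dist_set_has_inf and dist_set_has_sup show that this value is never used
   on nonempty compact sets. *)
Section hausdorff_distance.
Context {R : realType}.
Implicit Types (A B : set R) (x y : R).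

Definition dist_set x A : R := inf [set `|x - y| | y in A].

Definition hausdorff_dist A B : R :=
  Num.max (sup [set dist_set x B | x in A]) (sup [set dist_set y A | y in B]).

End hausdorff_distance.

Record compacts (R : realType) := Compacts {
  compacts_set :> set R ;
  compacts_compact : compact compacts_set ;
  compacts_nonempty : compacts_set !=set0
}.

Section compacts_metric.
Context {R : realType}.
Implicit Types (K L M : compacts R) (x y e : R).

Lemma compacts_inj K L : K = L :> set R -> K = L.
Proof.
case: K L => [K cK K0] [L cL L0] /= KL; rewrite KL in cK K0 *.
by congr Compacts; exact: Prop_irrelevance.
Qed.

Lemma dist_set_has_inf x L : has_inf [set `|x - y| | y in (L : set R)].
Proof.
case: (compacts_nonempty L) => y Ly; split; first by exists `|x - y|, y.
by exists 0 => _ [z _ <-].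
Qed.

Lemma dist_set_le x y L : (L : set R) y -> dist_set x L <= `|x - y|.
Proof.
by move=> Ly; apply: ge_inf; [case: (dist_set_has_inf x L)|exists y].
Qed.

Lemma le_dist_set e x L :
  (forall y, (L : set R) y -> e <= `|x - y|) -> e <= dist_set x L.
Proof.
move=> h; apply: lb_le_inf; first by case: (dist_set_has_inf x L).
by move=> _ [y Ly <-]; exact: h.
Qed.

Lemma dist_set_ge0 x L : 0 <= dist_set x L.
Proof. exact: le_dist_set. Qed.

Lemma dist_set_has_sup K L : has_sup [set dist_set x L | x in (K : set R)].
Proof.
case: (compacts_nonempty K) => x0 Kx0; split; first by exists (dist_set x0 L), x0.
case: (compacts_nonempty L) => y Ly.
have [N [_ /(_ (N + 1))]] := compact_bounded (@compacts_compact _ K).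
rewrite ltrDl => /(_ ltr01) KN; exists (N + 1 + `|y|) => _ [x Kx <-].
rewrite (le_trans (dist_set_le x Ly))// (le_trans (ler_normB _ _))// lerD2r.
exact: KN.
Qed.

Lemma hausdorff_distP K L e : hausdorff_dist K L <= e <->
  (forall x, (K : set R) x -> dist_set x L <= e) /\
  (forall y, (L : set R) y -> dist_set y K <= e).
Proof.
rewrite /hausdorff_dist ge_max; split=> [/andP[KL LK]|[KL LK]].
  split=> x xin.
    apply: le_trans KL; apply: ub_le_sup; last by exists x.
    by case: (dist_set_has_sup K L).
  apply: le_trans LK; apply: ub_le_sup; last by exists x.
  by case: (dist_set_has_sup L K).
apply/andP; split; apply: ge_sup.
- by case: (dist_set_has_sup K L).
- by move=> _ [x xin <-]; exact: KL.
- by case: (dist_set_has_sup L K).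
- by move=> _ [x xin <-]; exact: LK.
Qed.

Lemma hausdorff_dist_ge0 K L : 0 <= hausdorff_dist K L.
Proof.
have /hausdorff_distP[KL _] := lexx (hausdorff_dist K L).
have [x Kx] := compacts_nonempty K.
exact: le_trans (dist_set_ge0 x L) (KL _ Kx).
Qed.

Lemma hausdorff_distxx K : hausdorff_dist K K = 0.
Proof.
apply/eqP; rewrite eq_le hausdorff_dist_ge0 andbT; apply/hausdorff_distP.
by split=> x Kx; rewrite (le_trans (dist_set_le x Kx))// subrr normr0.
Qed.

Lemma hausdorff_dist_sym K L : hausdorff_dist K L = hausdorff_dist L K.
Proof. exact: maxC. Qed.

Lemma dist_set_eq0 x L : dist_set x L <= 0 -> (L : set R) x.
Proof.
move=> xL0; apply: (compact_closed (@Rhausdorff R) (@compacts_compact _ L)).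
move=> B /nbhs_ballP[e /= e0 xeB].
have [_ [y Ly <-] xy] := inf_lt (proj1 (dist_set_has_inf x L)) (le_lt_trans xL0 e0).
by exists y; split => //; exact: xeB.
Qed.

Lemma hausdorff_dist_eq0 K L : hausdorff_dist K L = 0 -> K = L.
Proof.
move=> KL0; have /hausdorff_distP[KL LK] : hausdorff_dist K L <= 0 by rewrite KL0.
by apply: compacts_inj; apply/seteqP; split=> x xin; apply: dist_set_eq0; auto.
Qed.

Lemma dist_set_triangle x L M e : (forall y, (L : set R) y -> dist_set y M <= e) ->
  dist_set x M <= dist_set x L + e.
Proof.
move=> LM; rewrite -lerBlDr; apply: le_dist_set => y Ly.
rewrite lerBlDr -lerBlDl; apply: le_trans (LM _ Ly).
apply: le_dist_set => z Mz; rewrite lerBlDl.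
rewrite (le_trans (dist_set_le x Mz))//.
by rewrite -(subrKA y) ler_normD.
Qed.

Lemma hausdorff_dist_triangle L K M :
  hausdorff_dist K M <= hausdorff_dist K L + hausdorff_dist L M.
Proof.
have /hausdorff_distP[KL LK] := lexx (hausdorff_dist K L).
have /hausdorff_distP[LM ML] := lexx (hausdorff_dist L M).
apply/hausdorff_distP; split=> x xin.
  by rewrite (le_trans (dist_set_triangle x LM))// lerD2r KL.
by rewrite addrC (le_trans (dist_set_triangle x LK))// lerD2r ML.
Qed.

HB.instance Definition _ := gen_eqMixin (compacts R).
HB.instance Definition _ := gen_choiceMixin (compacts R).
HB.instance Definition _ := @isMetric.Build R (compacts R)
  (fun K L => hausdorff_dist K L) hausdorff_distxx hausdorff_dist_eq0
  hausdorff_dist_sym hausdorff_dist_triangle.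

End compacts_metric.

Section visible.
Context {R : realType}.

(* The library builds the measurable sets of R from the intervals ]a, b]; they
   are the Borel sets. *)
Lemma measurable_borel : @measurable _ R = <<s @open R >>.
Proof.
apply/seteqP; split; last first.
  apply: smallest_sub; first exact: sigma_algebra_measurable.
  by move=> A; exact: open_measurable.
apply: smallest_sub; first exact: smallest_sigma_algebra.
move=> _ [[a b] _ <-].
have -> : `]a, b]%classic = `]a, +oo[%classic `\` `]b, +oo[%classic.
  apply/seteqP; split=> x /=; rewrite !in_itv/= !andbT.
    by move=> /andP[-> xb]; split => //; apply/negP; rewrite -leNgt.
  by move=> [-> /negP]; rewrite -leNgt.
have oG c : @open R `]c, +oo[%classic by exact: interval_open.
have H c := @sub_sigma_algebra _ setT _ _ (oG c).
by apply: (@measurableD _ (g_sigma_algebraType (@open R))); exact: H.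
Qed.

Definition translation_invariant (mu : {measure set R -> \bar R}) :=
  forall (A : set R) (t : R), measurable A -> mu [set x + t | x in A] = mu A.

Definition visible (K : set R) := exists mu : {measure set R -> \bar R},
  translation_invariant mu /\ (0 < mu K < +oo)%E.

End visible.

(* Main.v *)
(* A generic compact set K has no isolated points and is a Sidon set (an
   equation a + d = b + c between its points forces a = b or a = c), because
   finite Sidon sets all of whose points come in very close pairs are dense in
   the hyperspace, and each quantitative failure of the two properties is
   avoided by a ball around a suitable such set. On such a K put an atomless
   probability measure nu, the image of Lebesgue measure on [0, 1[ under a
   strictly increasing map into K, and let mu be the sum of all the translates
   of nu by real numbers. Then mu is translation invariant, and
   mu(K) = nu(K) = 1 since K meets each of its nontrivial translates in at most one point. *)
From HB Require Import structures.
Require Import Defs.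
From mathcomp Require Import all_boot all_order all_algebra.
From mathcomp Require Import all_classical all_reals all_analysis.
From mathcomp Require Import measurable_realfun lra.

Set Implicit Arguments.
Unset Strict Implicit.
Unset Printing Implicit Defensive.

Import Order.TTheory GRing.Theory Num.Theory.
Import numFieldNormedType.Exports.

Local Open Scope classical_set_scope.
Local Open Scope ring_scope.

(** * Sums of measures over an arbitrary index type *)

Section measure_esum.
Local Open Scope ereal_scope.
Context {d : measure_display} {T : measurableType d} {R : realType}.
Context {I : choiceType} (m : I -> {measure set T -> \bar R}).

(** [I] may be uncountable: below, translates are indexed by all real numbers. *)
Definition mesum (A : set T) : \bar R := \esum_(i in [set: I]) m i A.

Let mesum0 : mesum set0 = 0.
Proof. by apply: esum1 => i _; rewrite measure0. Qed.

Let mesum_ge0 A : 0 <= mesum A.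
Proof. by apply: esum_ge0 => i _. Qed.

(** Sums of nonnegative terms can be interchanged, whatever the index sets. *)
Let mesum_sigma_additive : semi_sigma_additive mesum.
Proof.
move=> F mF tF mUF.
suff <- : \sum_(0 <= n <oo) mesum (F n) = mesum (\bigcup_n F n).
  by apply: is_cvg_ereal_nneg_natsum => n _; exact: mesum_ge0.
rewrite nneseries_esumT// /mesum.
under [RHS]eq_esum => i _.
  rewrite (measure_semi_bigcup _ mF tF mUF) nneseries_esumT//.
  over.
rewrite !esum_esum//=.
rewrite (@reindex_esum _ _ _ ([set: nat] `*`` (fun=> [set: I]))
  ([set: I] `*`` (fun=> [set: nat])) (fun k => (k.2, k.1)))//.
by split => // [[n i] [n' i'] _ _ [-> ->]//|[i n] _]; exists (n, i).
Qed.

HB.instance Definition _ := isMeasure.Build _ _ _ mesum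
  mesum0 mesum_ge0 mesum_sigma_additive.

End measure_esum.

(** * Visibility from the sum of the translates of a measure *)

Section visible_criterion.
Context {R : realType}.
Implicit Types (g : R -> R) (K : set R).

Lemma measurable_fun_shift g (t : R) : {homo g : x y / x <= y} ->
  measurable_fun [set: R] (fun x => g x + t).
Proof.
by move=> hg; apply: nondecreasing_measurable => // x y xy; rewrite lerD2r hg.
Qed.

(* The image of Lebesgue measure on [0, 1[ under g is a measure without atoms
   carried by K, and mu is the sum of all its translates. *)
Lemma visible_of_translates g K : measurable K ->
  {homo g : x y / x <= y} ->
  (forall x, 0 <= x < 1 -> K (g x)) ->
  (forall t, t != 0 -> forall x y, 0 <= x < 1 -> 0 <= y < 1 ->
    K (g x + t) -> K (g y + t) -> x = y) ->
  visible K.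
Proof.
move=> mK hg gK inj.
pose nu := mrestr (@lebesgue_measure R) (measurable_itv `[0%R, 1%R[).
(* The measure structure of the pushforward rests on a measurability proof for each [t]; packing it
   in an existential yields a family indexed by [t]. *)
have shiftm t : exists m : {measure set R -> \bar R},
    m = pushforward nu (fun x => g x + t) :> (set R -> \bar R).
  unshelve eexists (pushforward nu (fun x => g x + t)) => //.
  exact: measurable_fun_shift.
pose m t := projT1 (cid (shiftm t)).
have mE t A : m t A = nu [set x | A (g x + t)].
  by rewrite /m; case: cid => /= m' ->.
exists (mesum m); split => [A t mA|].
  (* Translating [A] by [t] only permutes the summands: [m (s + t)] takes on the translate of [A]
     the value [m s A]. *)
  rewrite /= /mesum (@reindex_esum _ _ _ setT setT (fun s => s + t)).
    apply: eq_esum => s _; rewrite !mE; congr nu.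
    apply/seteqP; split=> x /=; first by move=> [y Ay]; rewrite addrA => /addIr <-.
    by move=> Ax; exists (g x + s) => //; rewrite addrA.
  by split => // [x y _ _ /addIr//|y _]; exists (y - t) => //; rewrite subrK.
have mK1 : mesum m K = 1%:E.
  (* Only the term at 0 counts: for [t != 0], at most one point of [0, 1[ is sent into [K], and a
     point is Lebesgue null. *)
  rewrite /mesum (esumID [set 0]); last by move=> t _; rewrite measure_ge0.
  rewrite setTI esum_set1; last exact: measure_ge0.
  rewrite esum1; last first.
    move=> t [_ /= /eqP t0]; rewrite mE /nu /mrestr/=.
    apply: countable_lebesgue_measure0.
    have [->|/set0P[x [/= Kx x01]]] :=
      eqVneq ([set x | K (g x + t)] `&` `[0, 1[) set0.
      exact: countable0.
    apply: (sub_countable _ (countable1 x)); apply: subset_card_le.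
    move=> y [/= Ky y01]; rewrite !in_itv/= in x01 y01.
    exact: (inj t t0 y x).
  rewrite adde0 mE /nu /mrestr.
  have -> : [set x | K (g x + 0)] `&` `[0, 1[ = `[0, 1[%classic.
    apply/seteqP; split => [x []//|x/= x01]; split => //.
    by rewrite /= addr0; apply: gK; rewrite in_itv/= in x01.
  by rewrite [LHS]lebesgue_measure_itv/= lte_fin ltr01 EFinN sube0.
by rewrite [X in (0 < X < _)%E]mK1 lte01 ltry.
Qed.
End visible_criterion.

(** * A strictly increasing map from [0, 1[ into a closed set without isolated points *)

Section increasing_map.
Context {R : realType}.
Implicit Types (K : set R) (ab : R * R) (x y : R).

Definition no_isolated_point K := forall x, K x -> forall e, 0 < e ->
  exists2 y, K y & y != x /\ `|x - y| < e.

Definition meets K a b := exists2 c, K c & a < c < b.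

Lemma meets_two K a b : no_isolated_point K -> meets K a b ->
  exists c d, [/\ K c, K d, a < c, c < d & d < b].
Proof.
move=> Kni [c Kc /andP[ac cb]].
have e0 : 0 < Num.min (c - a) (b - c) by rewrite lt_min !subr_gt0 ac.
have [d Kd [dc]] := Kni _ Kc _ e0.
rewrite lt_min !ltr_norml => /andP[/andP[cd1 cd2] /andP[cd3 cd4]].
by case/lt_total/orP: dc => h; [exists d, c|exists c, d]; split => //; lra.
Qed.

(** Take [p] midway between two points of [K] in the interval, and [q] the smaller of two points of
    [K] above [p]. *)
Lemma meets_split K a b : no_isolated_point K -> meets K a b ->
  exists p q, [/\ p < q, K q, meets K a p & meets K q b].
Proof.
move=> Kni /(meets_two Kni)[c [d [Kc Kd ac cd db]]].
have /(meets_two Kni)[q [e [Kq Ke mq qe eb]]] : meets K ((c + d) / 2) b.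
  by exists d => //; lra.
exists ((c + d) / 2), q; split => //; first by exists c => //; lra.
by exists e => //; rewrite qe.
Qed.

Context (K : set R) (split : R * R -> R * R).
Hypothesis cK : closed K.

(** The invariant of the subdivision: left ends stay in [K], and each interval can be split
    again. *)
Definition good ab := K ab.1 /\ meets K ab.1 ab.2.

Hypothesis splitP : forall ab, good ab ->
  [/\ (split ab).1 < (split ab).2, K (split ab).2,
      meets K ab.1 (split ab).1 & meets K (split ab).2 ab.2].

Definition child ab x :=
  if x < 1 / 2 then (ab.1, (split ab).1) else ((split ab).2, ab.2).

Definition shift x := if x < 1 / 2 then 2 * x else 2 * x - 1.

(* shift and the two branches of child follow the binary digits of x; for x
   outside [0, 1[ all digits are equal. *)
Fixpoint left_end n ab x : R :=
  if n is n'.+1 then left_end n' (child ab x) (shift x) else ab.1.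

(** On a good interval the left ends increase with [n], so this is their limit, a point of the
    closed set [K]. *)
Definition cantor_map ab x := sup (range (fun n => left_end n ab x)).

Lemma meets_lt a b : meets K a b -> a < b.
Proof. by move=> [c _ /andP[]]; exact: lt_trans. Qed.

Lemma good_child ab x : good ab -> good (child ab x).
Proof.
move=> gab; have [_ ? ? ?] := splitP gab; have [? _] := gab.
by rewrite /child; case: ifP.
Qed.

Lemma child_sub ab x : good ab ->
  ab.1 <= (child ab x).1 /\ (child ab x).2 <= ab.2.
Proof.
move=> gab; have [pq _ /meets_lt ap /meets_lt qb] := splitP gab.
by rewrite /child; case: ifP => /= _; split; lra.
Qed.

Lemma left_endP n ab x : good ab ->
  K (left_end n ab x) /\ ab.1 <= left_end n ab x <= ab.2.
Proof.
elim: n ab x => [|n IH] ab x gab /=.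
  by case: gab => ? /meets_lt/ltW ?; rewrite lexx.
have [? /andP[h1 h2]] := IH _ (shift x) (good_child x gab).
have [h3 h4] := child_sub x gab.
by split => //; apply/andP; split; lra.
Qed.

(** If the first digits agree, induction applies; otherwise the two values lie on either side of the
    gap left by [split]. *)
Lemma left_end_le n ab x y : good ab -> x <= y ->
  left_end n ab x <= left_end n ab y.
Proof.
elim: n ab x y => [//|n IH] ab x y gab xy /=.
have [] := left_endP n (shift x) (good_child x gab).
have [] := left_endP n (shift y) (good_child y gab).
have := IH _ (shift x) (shift y) (good_child x gab).
have [pq _ _ _] := splitP gab.
rewrite /child /shift; case: ltP => hx; case: ltP => hy /=.
- by move=> h _ _ _ _; apply: h; lra.
- by move=> _ _ /andP[? ?] _ /andP[? ?]; lra.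
- by move: hx hy; lra.
- by move=> h _ _ _ _; apply: h; lra.
Qed.

Lemma left_end_has_sup ab x : good ab ->
  has_sup (range (fun n => left_end n ab x)).
Proof.
move=> gab; split; first by exists (left_end 0 ab x), 0%N.
by exists ab.2 => _ [n _ <-]; have [_ /andP[]] := left_endP n x gab.
Qed.

Lemma left_end_le_map n ab x : good ab -> left_end n ab x <= cantor_map ab x.
Proof.
move=> gab; apply: sup_upper_bound; last by exists n.
exact: left_end_has_sup.
Qed.

Lemma cantor_map_le ab x M : good ab ->
  (forall n, left_end n ab x <= M) -> cantor_map ab x <= M.
Proof.
move=> gab h; apply: ge_sup; first by case: (left_end_has_sup x gab).
by move=> _ [n _ <-].
Qed.

Lemma cantor_mapP ab x : good ab ->
  K (cantor_map ab x) /\ ab.1 <= cantor_map ab x <= ab.2.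
Proof.
move=> gab; split; last first.
  rewrite (left_end_le_map 0)//=; apply: cantor_map_le => // n.
  by have [_ /andP[]] := left_endP n x gab.
apply: cK; have [h1 h2] := left_end_has_sup x gab.
apply: closure_subset (closure_sup h1 h2) => _ [n _ <-].
by have [] := left_endP n x gab.
Qed.

Lemma cantor_map_homo ab : good ab -> {homo cantor_map ab : x y / x <= y}.
Proof.
move=> gab x y xy; apply: cantor_map_le => // n.
exact: le_trans (left_end_le n gab xy) (left_end_le_map n y gab).
Qed.

(** Passing to the child drops only the initial left end [ab.1], which the later ones dominate. *)
Lemma cantor_map_child ab x : good ab ->
  cantor_map ab x = cantor_map (child ab x) (shift x).
Proof.
move=> gab; have gc := good_child x gab.
apply/eqP; rewrite eq_le; apply/andP; split.
  apply: cantor_map_le => // -[|n] /=; last exact: left_end_le_map.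
  have [h _] := child_sub x gab; apply: le_trans h _.
  exact: (left_end_le_map 0).
by apply: cantor_map_le => // n; exact: (left_end_le_map n.+1).
Qed.

(** While the digits of [x] and [y] agree, [shift] doubles their distance, which stays below 1. So
    some digit differs, and there the gap separates the values. *)
Lemma cantor_map_lt ab x y : good ab -> 0 <= x -> x < y -> y < 1 ->
  cantor_map ab x < cantor_map ab y.
Proof.
move=> gab x0 xy y1.
have [n] : exists n, 1 <= 2 ^+ n * (y - x).
  have [n hn] : exists n : nat, (y - x)^-1 <= n%:R.
    exists (Num.bound (y - x)^-1); apply: ltW.
    by rewrite archi_boundP// invr_ge0 subr_ge0 ltW.
  exists n; rewrite -ler_pdivrMr ?subr_gt0// mul1r (le_trans hn)//.
  by rewrite -natrX ler_nat ltnW// ltn_expl.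
elim: n ab x y gab x0 xy y1 => [|n IH] ab x y gab x0 xy y1.
  by rewrite expr0 mul1r; lra.
rewrite exprSr -mulrA => hn.
rewrite !(cantor_map_child _ gab).
have := IH _ (shift x) (shift y) (good_child x gab).
have [_] := cantor_mapP (shift x) (good_child x gab).
have [_] := cantor_mapP (shift y) (good_child y gab).
have [pq _ _ _] := splitP gab.
rewrite /child /shift; case: ltP => hx; case: ltP => hy /=.
- move=> _ _ h; apply: h; [lra|lra|lra|].
  by rewrite -mulrBr.
- by move=> /andP[? ?] /andP[? ?] _; lra.
- by move: hx hy; lra.
- move=> _ _ h; apply: h; [lra|lra|lra|].
  by rewrite (_ : 2 * y - 1 - (2 * x - 1) = 2 * (y - x))//; lra.
Qed.

End increasing_map.

Lemma increasing_map_into (R : realType) (K : set R) :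
  closed K -> no_isolated_point K -> K !=set0 ->
  exists g : R -> R, [/\ {homo g : x y / x <= y}, forall x, K (g x) &
    forall x y, 0 <= x -> x < y -> y < 1 -> g x < g y].
Proof.
move=> cK Kni [c Kc].
have [split splitP] : {split : R * R -> R * R & forall ab, good K ab ->
    [/\ (split ab).1 < (split ab).2, K (split ab).2,
        meets K ab.1 (split ab).1 & meets K (split ab).2 ab.2]}.
  apply: (@choice _ _ (fun ab pq => good K ab -> [/\ pq.1 < pq.2, K pq.2,
        meets K ab.1 pq.1 & meets K pq.2 ab.2])) => ab.
  have [[_ /(meets_split Kni)[p [q ?]]]|?] := pselect (good K ab).
    by exists (p, q).
  (* A default value on intervals that are not good. *)
  by exists (0, 0).
have [a [b [Ka Kb _ ab _]]] : exists a b, [/\ K a, K b, c - 1 < a, a < b & b < c + 1].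
  by apply: meets_two => //; exists c => //; lra.
(* The right end is moved past [b] because [meets] asks for a point strictly inside. *)
have gab : good K (a, b + 1) by split => //; exists b => //=; lra.
exists (cantor_map split (a, b + 1)); split.
- exact: (cantor_map_homo splitP gab).
- by move=> x; have [] := cantor_mapP cK splitP x gab.
- by move=> x y; exact: (cantor_map_lt cK splitP gab).
Qed.

(** * Finite Sidon sets *)

Section sidon_sets.
Context {R : realType}.
Implicit Types (A : set R) (s L : seq R) (x y e : R).

(** The four points may coincide, so nontrivial three-term arithmetic progressions are excluded
    too. *)
Definition sidon A := forall a b c d, A a -> A b -> A c -> A d ->
  a + d = b + c -> a = b \/ a = c.

Lemma exists_notin_itv s a b : a < b -> exists2 y, a < y < b & y \notin s.
Proof.
move=> ab; have [a' [b' [a'b' aa' b'b h]]] : exists a' b',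
    [/\ a' < b', a <= a', b' <= b & forall y, a' < y < b' -> y \notin s].
  elim: s => [|x s [a' [b' [a'b' aa' b'b h]]]]; first by exists a, b.
  have [xm|mx] := leP x ((a' + b') / 2).
    exists ((a' + b') / 2), b'; split; [lra|lra|lra|] => y /andP[y1 y2].
    by rewrite in_cons negb_or gt_eqF/=; [apply: h|]; lra.
  exists a', ((a' + b') / 2); split; [lra|lra|lra|] => y /andP[y1 y2].
  by rewrite in_cons negb_or lt_eqF/=; [apply: h|]; lra.
by exists ((a' + b') / 2); [lra|apply: h; lra].
Qed.

Lemma sidon_extend L x e : 0 < e -> sidon [set` L] ->
  exists y, [/\ `|x - y| < e, y \notin L & sidon [set` y :: L]].
Proof.
move=> e0 sL.
pose S2 := [seq b + c | b <- L, c <- L].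
(* The finitely many [y] to avoid: solutions of [y + d = b + c], solutions of [y + y = b + c], and
   the points of [L]. *)
pose bad := [seq u - d | u <- S2, d <- L] ++ [seq u / 2 | u <- S2] ++ L.
have [y yx] := @exists_notin_itv bad (x - e) (x + e) ltac:(lra).
rewrite !mem_cat !negb_or => /and3P[y1 y2 yL].
exists y; split => //; first by rewrite ltr_norml; lra.
have S2P b c : b \in L -> c \in L -> b + c \in S2 by move=> *; exact: allpairs_f.
have n1 b c d : b \in L -> c \in L -> d \in L -> y + d = b + c -> False.
  move=> bL cL dL h; move/negP: y1; apply; apply/allpairsP.
  by exists (b + c, d); rewrite S2P//=; split => //; lra.
have n2 b c : b \in L -> c \in L -> y + y = b + c -> False.
  move=> bL cL h; move/negP: y2; apply; apply/mapP.
  by exists (b + c); [exact: S2P|lra].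
move=> a b c d /=; rewrite !in_cons.
move=> /predU1P[->|aL] /predU1P[->|bL] /predU1P[->|cL] /predU1P[->|dL] h;
  try (by left); try (by right).
- by have := n2 _ _ bL cL h.
- by have := n1 _ _ _ bL cL dL h.
- by left; lra.
- by have := n2 _ _ aL dL (esym h).
- by right; lra.
- by have := n1 _ _ _ aL dL cL (esym h).
- by left; lra.
- by have := n1 _ _ _ aL dL bL; rewrite addrC; move/(_ (esym h)).
- by have := n1 _ _ _ bL cL aL; rewrite addrC; move/(_ h).
- exact: sL h.
Qed.

(** Each point of [s] contributes two new points within [e] of it, added by successive extensions;
    they are each other's close neighbours. *)
Lemma sidon_net s e : 0 < e -> exists L, [/\ sidon [set` L],
  forall x, x \in s -> exists2 y, y \in L & `|x - y| < e,
  forall y, y \in L -> exists2 x, x \in s & `|x - y| < e &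
  forall y, y \in L -> exists2 z, z \in L & z != y /\ `|y - z| < 2 * e].
Proof.
move=> e0; elim: s => [|x s [L [sL h1 h2 h3]]]; first by exists [::].
have [y [xy yL]] := sidon_extend x e0 sL.
move=> /(sidon_extend x e0)[z [xz]]; rewrite in_cons negb_or => /andP[zy zL] szL.
exists [:: z, y & L]; split => //.
- move=> u; rewrite in_cons => /predU1P[->|/h1[v vL uv]].
    by exists z; rewrite ?mem_head.
  by exists v; rewrite // !in_cons vL !orbT.
- move=> u; rewrite !in_cons => /or3P[/eqP ->|/eqP ->|/h2[v vs uv]].
  + by exists x; rewrite ?mem_head.
  + by exists x; rewrite ?mem_head.
  + by exists v; rewrite // in_cons vs orbT.
- have yz : `|y - z| < 2 * e.
    rewrite (_ : y - z = (x - z) - (x - y)); last lra.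
    by rewrite (le_lt_trans (ler_normB _ _))//; lra.
  move=> u; rewrite !in_cons => /or3P[/eqP ->|/eqP ->|/h3[v vL uv]].
  + by exists y; rewrite ?in_cons ?eqxx ?orbT// eq_sym distrC.
  + by exists z; rewrite ?in_cons ?eqxx ?orbT.
  + by exists v; rewrite // !in_cons vL !orbT.
Qed.

Lemma seq_gap s : exists2 e, 0 < e & forall x, x \in s -> x != 0 -> e <= `|x|.
Proof.
elim: s => [|x s [e e0 h]]; first by exists 1.
have [->|x0] := eqVneq x 0.
  by exists e => // y; rewrite in_cons => /predU1P[->|/h]//; rewrite eqxx.
exists (Num.min e `|x|); first by rewrite lt_min e0 normr_gt0.
move=> y; rewrite in_cons ge_min => /predU1P[-> _|/h{}h /h ->//].
by rewrite lexx orbT.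
Qed.

(** Finitely many differences of sums occur, and those considered here are nonzero. *)
Lemma sidon_gap L : sidon [set` L] -> exists2 e, 0 < e &
  forall a b c d, a \in L -> b \in L -> c \in L -> d \in L ->
  a != b -> a != c -> e <= `|a + d - (b + c)|.
Proof.
move=> sL; pose S2 := [seq b + c | b <- L, c <- L].
have [e e0 h] := seq_gap [seq u - v | u <- S2, v <- S2].
exists e => // a b c d aL bL cL dL ab ac; apply: h.
  by do 2!apply: allpairs_f => //.
rewrite subr_eq0; apply/eqP => /(sL _ _ _ _ aL bL cL dL)[]/eqP.
  exact/negP.
exact/negP.
Qed.

End sidon_sets.

(** * Criteria for nowhere dense and meager sets *)

Section category.

(** A ball around [y] that misses [A] keeps [y] out of the closure, so the closure contains no
    ball. *)
Lemma nowhere_denseP (R : numFieldType) (T : pseudoMetricType R) (A : set T) :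
  (forall x e, 0 < e -> exists y d,
    [/\ ball x e y, 0 < d & forall z, ball y d z -> ~ A z]) ->
  nowhere_dense A.
Proof.
move=> h; apply/seteqP; split => // x /nbhs_ballP[e /= e0 xe].
have [y [d [/xe yA d0 yd]]] := h x e e0.
have [z [Az yz]] := yA _ (nbhsx_ballx y d d0).
exact: yd Az.
Qed.

Lemma nowhere_denseS (T : topologicalType) (A B : set T) :
  A `<=` B -> nowhere_dense B -> nowhere_dense A.
Proof.
move=> AB B0; apply/seteqP; split => // x.
by move=> /(interiorS (closure_subset AB)); rewrite B0.
Qed.

(** [meager] asks for an equality with the union; intersecting each [F n] with [A] provides it. *)
Lemma meager_sub_bigcup (T : topologicalType) (A : set T) (F : (set T)^nat) :
  (forall n, nowhere_dense (F n)) -> A `<=` \bigcup_n F n -> meager A.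
Proof.
move=> F0 AF; exists (fun n => A `&` F n); split.
  by move=> n; apply: nowhere_denseS (F0 n) => x [].
by rewrite -setI_bigcupr; apply/esym/setIidl.
Qed.

End category.

(** * Pointwise approximation in the Hausdorff metric *)

Section hausdorff_ball.
Context {R : realType}.
Implicit Types (K L : compacts R) (e : R).

Lemma hausdorff_dist_lt K L e : hausdorff_dist K L < e ->
  forall x, (K : set R) x -> exists2 y, (L : set R) y & `|x - y| < e.
Proof.
move=> KL x Kx; have /hausdorff_distP[h _] := lexx (hausdorff_dist K L).
have [_ [y Ly <-] xy] :=
  inf_lt (proj1 (dist_set_has_inf x L)) (le_lt_trans (h x Kx) KL).
by exists y.
Qed.

Lemma hausdorff_dist_le K L e :
  (forall x, (K : set R) x -> exists2 y, (L : set R) y & `|x - y| <= e) ->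
  (forall y, (L : set R) y -> exists2 x, (K : set R) x & `|x - y| <= e) ->
  hausdorff_dist K L <= e.
Proof.
move=> KL LK; apply/hausdorff_distP; split => x.
  by move=> /KL[y Ly]; exact/le_trans/dist_set_le.
by move=> /LK[y Ky]; rewrite distrC; exact/le_trans/dist_set_le.
Qed.

Lemma compact_net K e : 0 < e -> exists s : seq R,
  (forall y, y \in s -> (K : set R) y) /\
  (forall x, (K : set R) x -> exists2 y, y \in s & `|x - y| < e).
Proof.
move=> e0; have := @compacts_compact _ K; rewrite compact_cover.
move=> /(_ R K (fun y => ball y e)) [y _|x Kx|D DK KD].
- exact: ball_open.
- by exists x => //; exact: ballxx.
exists (finmap.enum_fset D); split => [y /DK/set_mem//|x /KD[y yD]].
by rewrite /ball/= distrC => xy; exists y.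
Qed.

End hausdorff_ball.

(** * Generic compact sets are Sidon sets without isolated points *)

Section generic.
Context {R : realType}.
Implicit Types (K L : compacts R) (n : nat).

(** The bound turns the existence of an isolated point into a countable union of conditions;
    [non_sidon_by] does the same for the Sidon property. *)
Definition isolated_by n := [set K : compacts R | exists2 x, (K : set R) x &
  forall y, (K : set R) y -> y != x -> n.+1%:R^-1 <= `|x - y|].

Definition non_sidon_by n := [set K : compacts R | exists a b c d,
  [/\ (K : set R) a, (K : set R) b, (K : set R) c, (K : set R) d & a + d = b + c] /\
  n.+1%:R^-1 <= `|a - b| /\ n.+1%:R^-1 <= `|a - c|].

Lemma nowhere_dense_bad n : nowhere_dense (isolated_by n `|` non_sidon_by n).
Proof.
apply: nowhere_denseP => K e e0; set r : R := n.+1%:R^-1.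
have r0 : 0 < r by rewrite invr_gt0.
have e40 : 0 < e / 4 by lra.
have [s [sK Ks]] := compact_net K e40.
(* [e / 4] keeps the finite set within [e / 2] of [K]; [r / 4] puts the points of a pair less than
   [r / 2] apart. *)
have f0 : 0 < Num.min (e / 4) (r / 4) by rewrite lt_min; lra.
set f := Num.min (e / 4) (r / 4) in f0.
have [fe fr] : f <= e / 4 /\ f <= r / 4 by rewrite /f !ge_min !lexx orbT.
have [l [sl sL Ls Ll]] := sidon_net s f0.
have [g g0 gap] := sidon_gap sl.
have lc : compact [set` l] by apply: finite_compact; exact: finite_seq.
have l0 : [set` l] !=set0.
  have [x /Ks[y /sL[z zl _] _]] := compacts_nonempty K; by exists z.
pose L := Compacts lc l0.
(* Moving four points by less than [g / 4] cannot close a gap [g]; moving two by less than [r / 4]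
   changes their distance by less than [r / 2]. *)
have d0 : 0 < Num.min (g / 4) (r / 4) by rewrite lt_min; lra.
set d := Num.min (g / 4) (r / 4) in d0.
have [dg dr] : d <= g / 4 /\ d <= r / 4 by rewrite /d !ge_min !lexx orbT.
exists L, d; split => //.
  rewrite ballEmdist/=; apply: (@le_lt_trans _ _ (e / 2)); last lra.
  apply: hausdorff_dist_le => [x /Ks[y /sL[z zl yz] xy]|z /Ls[y ys yz]].
    exists z => //; rewrite -(subrKA y) (le_trans (ler_normD _ _))//; lra.
  by exists y; [exact: sK|lra].
move=> M; rewrite ballEmdist/= => LM.
have LM' := hausdorff_dist_lt LM; move: LM.
rewrite [X in X < _]hausdorff_dist_sym => /hausdorff_dist_lt ML.
case.
  move=> [x Mx xiso]; have [a al xa] := ML _ Mx.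
  have [a' a'l [a'a aa']] := Ll _ al; have [y My ay] := LM' _ a'l.
  (* The gap for [a' + a'] and [a + a] puts the pair at least [g / 2] apart, so the points [x] and
     [y] of [M] near them differ. *)
  have ga := gap a' a a a' a'l al al a'l a'a a'a.
  have gaa : g / 2 <= `|a' - a|.
    move: ga; rewrite (_ : a' + a' - (a + a) = 2 * (a' - a)); last lra.
    by rewrite normrM ger0_norm; lra.
  have yx : y != x.
    apply/eqP => yx; move: ay xa gaa; rewrite yx.
    by rewrite !ltr_norml leNgt ltr_norml; lra.
  have := xiso _ My yx; rewrite -/r leNgt => /negP; apply.
  by move: aa' ay xa; rewrite !ltr_norml; lra.
move=> [a [b [c [h [[Ma Mb Mc Mh] abch [ab ac]]]]]].
have [a' a'l aa] := ML _ Ma; have [b' b'l bb] := ML _ Mb.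
have [c' c'l cc] := ML _ Mc; have [h' h'l hh] := ML _ Mh.
(* Points at distance at least [r] cannot share an approximant within [r / 4], so the gap applies to
   the approximants. *)
have ab' : a' != b'.
  apply/eqP => h1; move: ab aa bb; rewrite h1 -/r leNgt !ltr_norml; lra.
have ac' : a' != c'.
  apply/eqP => h1; move: ac aa cc; rewrite h1 -/r leNgt !ltr_norml; lra.
have := gap _ _ _ _ a'l b'l c'l h'l ab' ac'.
by rewrite leNgt; move: aa bb cc hh; rewrite !ltr_norml; lra.
Qed.

Lemma no_isolated_sidon_visible K :
  no_isolated_point (K : set R) -> sidon (K : set R) -> visible K.
Proof.
move=> Kni sK; have cK : closed (K : set R).
  exact: (compact_closed (@Rhausdorff R) (@compacts_compact _ K)).
have [g [gle gK glt]] := increasing_map_into cK Kni (compacts_nonempty K).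
apply: (@visible_of_translates _ g) => //.
  exact: closed_measurable.
move=> t t0 x y /andP[x0 x1] /andP[y0 y1] Kx Ky.
(* All four points lie in [K], so the Sidon property gives [t = 0] or [g x = g y]. *)
have : g x + (g y + t) = g x + t + g y by lra.
move=> /(sK _ _ _ _ (gK x) Kx (gK y) Ky)[gxt|gxy].
  by case/eqP: t0; lra.
apply/eqP; apply: contraT => /lt_total/orP[xy|yx].
  by have := glt x y x0 xy y1; rewrite gxy ltxx.
by have := glt y x y0 yx x1; rewrite gxy ltxx.
Qed.

End generic.

Theorem theorem3p8 (R : realType) : comeager [set K : compacts R | visible K].
Proof.
apply: (meager_sub_bigcup (@nowhere_dense_bad R)) => K /= nv.
(* A [K] outside all the bad sets has both properties, since some 1/(n+1) lies below any given
   positive bound. *)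
apply: contrapT => Kgood; apply: nv.
have invn (e : R) : 0 < e -> exists n : nat, n.+1%:R^-1 < e.
  move=> e0; have [n _ /(_ n (leqnn n)) h] := near_infty_natSinv_lt (PosNum e0).
  by exists n.
apply: no_isolated_sidon_visible.
  move=> x Kx e /invn[n ne]; apply: contrapT => h; apply: Kgood.
  exists n => //; left; exists x => // y Ky yx.
  rewrite leNgt; apply/negP => xy; apply: h; exists y => //; split => //.
  exact: lt_trans ne.
move=> a b c d Ka Kb Kc Kd abcd; have [ab|ab] := eqVneq a b; first by left.
have [ac|ac] := eqVneq a c; first by right.
have [|n ne] := invn (Num.min `|a - b| `|a - c|).
  by rewrite lt_min !normr_gt0 !subr_eq0 ab.
exfalso; apply: Kgood; exists n => //; right; exists a, b, c, d; split => //.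
by move: ne; rewrite lt_min => /andP[/ltW ? /ltW ?].
Qed.
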